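(* Let $(\mathcal X_0,\mu_0)$, $(\mathcal X_1,\mu_1)$ be finite probability spaces and let $\kappa_0:\mathcal X_0\times\mathcal X_0\to\mathbb R$, $\kappa_1:\mathcal X_1\times\mathcal X_1\to\mathbb R$ be both PSD or both NSD kernels. Let $q\in\mathbb N\setminus\{0\}$ and set $\mathsf C(\mu_0,\mu_1)=\iint\kappa_0^{2q}\,d\mu_0d\mu_0+\iint\kappa_1^{2q}\,d\mu_1d\mu_1$. Then, for each $\varepsilon\ge0$, $$\mathsf{EGW}^\varepsilon_{2,q}(\mu_0,\mu_1)=\mathsf C(\mu_0,\mu_1)+\inf_{u\in\mathbb R^r}\left\{\tfrac12\|u\|^2+\min_{\mathrm Ax=b,\; x\ge0}\left\{-u^{\intercal}\mathrm Bx-\varepsilon\mathsf H(x)\right\}\right\},$$ where $\mathrm B\in\mathbb R^{r\times N_0N_1}$ satisfies $\mathrm M=\mathrm B^{\intercal}\mathrm B$ and $r\le N_0N_1$.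
   Context: A PSD (resp. NSD) kernel $k$ on $\mathcal X$ is a symmetric function such that for every finite tuple $(x_1,\dots,x_s)$ of points of $\mathcal X$ the matrix $(k(x_l,x_m))_{l,m}$ is positive (resp. negative) semidefinite. Write $\mathcal X_0=\{x_0^{(1)},\dots,x_0^{(N_0)}\}$, $\mathcal X_1=\{x_1^{(1)},\dots,x_1^{(N_1)}\}$. $\Pi(\mu_0,\mu_1)$ is the set of couplings of $\mu_0,\mu_1$. For $\varepsilon\ge0$, $$\mathsf{EGW}^\varepsilon_{2,q}(\mu_0,\mu_1)=\inf_{\pi\in\Pi(\mu_0,\mu_1)}\iint|\kappa_0^q(x,x')-\kappa_1^q(y,y')|^2\,d\pi(x,y)\,d\pi(x',y')-\varepsilon\mathsf H(\pi),$$ with $\mathsf H(\pi)=-\sum_{(x_0,x_1)}\pi(\{(x_0,x_1)\})\log\pi(\{(x_0,x_1)\})$, $0\log0=0$; here $\kappa^q$ is the pointwise $q$-th power. Couplings are identified with vectors $x\in\mathbb R^{N_0N_1}$, $x=\operatorname{vec}(\mathrm P)$ (stacking columns), where $\mathrm P\in\mathbb R^{N_1\times N_0}$, $\mathrm P_{lm}=\pi(\{(x_0^{(m)},x_1^{(l)})\})$. The constraint $\pi\in\Pi(\mu_0,\mu_1)$ is $\mathrm Ax=b$, $x\ge0$, where $$\mathrm A=\begin{pmatrix}\mathrm{Id}_{N_0}\otimes\mathbf 1_{N_1}^{\intercal}\\ \mathbf 1_{N_0}^{\intercal}\otimes\mathrm{Id}_{N_1}\end{pmatrix}\in\mathbb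 R^{(N_0+N_1)\times N_0N_1},$$ $b=(\mu_0(\{x_0^{(1)}\}),\dots,\mu_0(\{x_0^{(N_0)}\}),\mu_1(\{x_1^{(1)}\}),\dots,\mu_1(\{x_1^{(N_1)}\}))^{\intercal}$, $\mathbf 1_N$ is the all-ones vector, $\otimes$ the Kronecker product. Moreover $$\mathrm M=4\left(\kappa_0^q(x_0^{(i)},x_0^{(j)})\right)_{i,j=1}^{N_0}\otimes\left(\kappa_1^q(x_1^{(i)},x_1^{(j)})\right)_{i,j=1}^{N_1}.$$ For a vector $x$, $\mathsf H(x)=-\sum_ix_i\log x_i$ if $x\ge0$ and $-\infty$ otherwise. *)

(* Defs.v *)
From HB Require Import structures.
From mathcomp Require Export all_boot all_order all_algebra.
From mathcomp Require Export mxtens.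
From mathcomp Require Export all_classical all_reals all_analysis.

Set Implicit Arguments.
Unset Strict Implicit.
Unset Printing Implicit Defensive.

Import Order.TTheory GRing.Theory Num.Theory.

Local Open Scope classical_set_scope.
Local Open Scope ring_scope.

Definition psdmx (R : realType) (n : nat) (A : 'M[R]_n) : Prop :=
  A^T = A /\ forall v : 'cV[R]_n, 0 <= (v^T *m A *m v) ord0 ord0.

Definition nsdmx (R : realType) (n : nat) (A : 'M[R]_n) : Prop :=
  A^T = A /\ forall v : 'cV[R]_n, (v^T *m A *m v) ord0 ord0 <= 0.

Definition kernel_mx (R : realType) (X : Type) (k : X -> X -> R)
    (n : nat) (x : 'I_n -> X) : 'M[R]_n :=
  \matrix_(l, m) k (x l) (x m).

Definition psd_kernel (R : realType) (X : Type) (k : X -> X -> R) : Prop :=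
  (forall x y, k x y = k y x) /\
  forall (s : nat) (x : 'I_s -> X), psdmx (kernel_mx k x).

Definition nsd_kernel (R : realType) (X : Type) (k : X -> X -> R) : Prop :=
  (forall x y, k x y = k y x) /\
  forall (s : nat) (x : 'I_s -> X), nsdmx (kernel_mx k x).

Definition kernel_pow (R : realType) (X : Type) (k : X -> X -> R) (q : nat) :
  X -> X -> R := fun x y => k x y ^+ q.

Section Couplings.
Context (R : realType) (d0 d1 : measure_display).
Context (X0 : measurableType d0) (X1 : measurableType d1).

Definition couplings (mu0 : probability X0 R) (mu1 : probability X1 R) :
    set (probability (X0 * X1)%type R) :=
  [set pi | (forall A, measurable A -> pushforward pi fst A = mu0 A) /\
            (forall A, measurable A -> pushforward pi snd A = mu1 A)].

(* Only meant for finite X0 and X1: a finitely supported sum over a set with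
   infinitely many nonzero terms is 0 by convention.  The convention
   0 log 0 = 0 holds because of the factor 0. *)
Definition coupling_entropy (pi : probability (X0 * X1)%type R) : R :=
  - \sum_(z \in [set: X0 * X1])
      (fine (pi [set z]) * ln (fine (pi [set z]))).

Definition EGW2 (eps : R) (q : nat) (k0 : X0 -> X0 -> R) (k1 : X1 -> X1 -> R)
    (mu0 : probability X0 R) (mu1 : probability X1 R) : \bar R :=
  ereal_inf [set
    (\int[pi]_z \int[pi]_z'
       (`|kernel_pow k0 q z.1 z'.1 - kernel_pow k1 q z.2 z'.2| ^+ 2)%:E
     - (eps * coupling_entropy pi)%:E)%E
    | pi in couplings mu0 mu1].

Definition EGW_const (q : nat) (k0 : X0 -> X0 -> R) (k1 : X1 -> X1 -> R)
    (mu0 : probability X0 R) (mu1 : probability X1 R) : \bar R :=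
  (\int[mu0]_x \int[mu0]_x' (kernel_pow k0 (2 * q) x x')%:E
   + \int[mu1]_y \int[mu1]_y' (kernel_pow k1 (2 * q) y y')%:E)%E.

End Couplings.

Section Vectorized.
Context (R : realType).

(* [A *t B] has the entry A i k * B j l in row i * p + j and column k * q + l
   (B of size p x q): it is the Kronecker product for the column-stacking
   vectorization, so coordinate m * N1 + l of a vector in R^(N0 * N1) is the
   mass of the pair (x0 m, x1 l).  The cast identifies the row dimension
   N0 * 1 + 1 * N1 with N0 + N1. *)
Definition coupling_mx (N0 N1 : nat) : 'M[R]_(N0 + N1, N0 * N1) :=
  castmx (f_equal2 addn (muln1 N0) (mul1n N1), erefl (N0 * N1)%N)
    (col_mx (1%:M *t const_mx 1) (const_mx 1 *t 1%:M)).

Definition marginal_vec (d0 d1 : measure_display)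
    (X0 : measurableType d0) (X1 : measurableType d1)
    (mu0 : probability X0 R) (mu1 : probability X1 R) (N0 N1 : nat)
    (x0 : 'I_N0 -> X0) (x1 : 'I_N1 -> X1) : 'cV[R]_(N0 + N1) :=
  col_mx (\col_i fine (mu0 [set x0 i])) (\col_j fine (mu1 [set x1 j])).

Definition cost_mx (X0 X1 : Type) (k0 : X0 -> X0 -> R) (k1 : X1 -> X1 -> R)
    (q N0 N1 : nat) (x0 : 'I_N0 -> X0) (x1 : 'I_N1 -> X1) :
    'M[R]_(N0 * N1) :=
  4 *: (kernel_mx (kernel_pow k0 q) x0 *t kernel_mx (kernel_pow k1 q) x1).

Definition feasible (m n : nat) (A : 'M[R]_(m, n)) (b : 'cV[R]_m) :
    set 'cV[R]_n :=
  [set x | A *m x = b /\ forall i, 0 <= x i ord0].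

Definition vec_entropy (n : nat) (x : 'cV[R]_n) : \bar R :=
  if [forall i, 0 <= x i ord0]
  then (- \sum_(i < n) x i ord0 * ln (x i ord0))%:E else -oo%E.

Definition inner_values (m n r : nat) (A : 'M[R]_(m, n)) (b : 'cV[R]_m)
    (B : 'M[R]_(r, n)) (eps : R) (u : 'cV[R]_r) : set (\bar R) :=
  [set ((- (u^T *m B *m x) ord0 ord0)%:E - eps%:E * vec_entropy x)%E
  | x in feasible A b].

Definition is_min (S : set (\bar R)) (v : \bar R) : Prop :=
  S v /\ lbound S v.

(* The norm `|u| on column vectors is the sup norm, hence a separate
   Euclidean one. *)
Definition sqnorm2 (r : nat) (u : 'cV[R]_r) : R :=
  \sum_(i < r) u i ord0 ^+ 2.

End Vectorized.

(* Main.v *)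
Require Import Defs.
From HB Require Import structures.
From mathcomp Require Import ring lra.
Import Order.TTheory GRing.Theory Num.Theory.
Import numFieldNormedType.Exports.

Set Implicit Arguments.
Unset Strict Implicit.
Unset Printing Implicit Defensive.

Local Open Scope classical_set_scope.
Local Open Scope ring_scope.

(** Existence of [B].  A positive semidefinite matrix is a Gram matrix
    ([psdmx_factor], by Cholesky elimination), and Gram matrices are stable
    under entrywise products and tensor products.  Hence the entrywise powers of
    PSD kernel matrices, and then the cost matrix, are Gram matrices
    ([cost_mx_factor]).  Two NSD kernels reduce to two PSD ones: changing both
    signs multiplies the cost matrix by the square of [(-1) ^+ q].

    The duality.  Probabilities on a finite discrete space are vectors of
    masses, and the couplings correspond exactly to the feasible vectors
    ([coupling_feasible], [feasible_coupling]).  Expanding the square in the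
    objective, the two pure terms depend on the marginals only and add up to the
    constant, while the cross term is minus one half of [x^T M x], that is of
    the squared norm of [B x] ([EGW2_feasible]).  What remains is to linearize
    this concave term: minus half of the squared norm of [y] is the minimum over
    [u] of half the squared norm of [u] minus the scalar product of [u] and [y],
    attained at [u = y] ([sqnorm2_dual_ge], [sqnorm2_dual_eq]).  Taking
    [y = B x] and exchanging the two infima gives the formula
    ([ereal_inf_quadratic_dual]).

    The inner minimum is attained because the feasible set is nonempty (product
    coupling) and compact, and because the objective is continuous, including
    where coordinates vanish, as [t * ln t] tends to [0] at [0]
    ([inner_values_min]). *)

(** * Positive semidefinite matrices are Gram matrices *)

Lemma gram_psdmx (R : realType) r n (B : 'M[R]_(r, n)) : psdmx (B^T *m B).
Proof.
split=> [|v]; first by rewrite trmx_mul trmxK.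
rewrite mulmxA -mulmxA -trmx_mul mxE sumr_ge0// => i _.
by rewrite mxE -expr2 sqr_ge0.
Qed.

(** This is the quadratic form evaluated at [t e_i + e_j]. *)
Lemma psdmx_minor2 (R : realType) n (A : 'M[R]_n) i j (t : R) :
  psdmx A -> 0 <= t ^+ 2 * A i i + 2 * t * A i j + A j j.
Proof.
case=> symA /(_ (t *: delta_mx i ord0 + delta_mx j ord0)).
have entry k l :
    ((delta_mx k ord0)^T *m A *m delta_mx l ord0) ord0 ord0 = A k l.
  rewrite mxE (bigD1 l) //= big1 => [|m ml].
    rewrite !mxE (bigD1 k) //= big1 => [|m mk].
      by rewrite !mxE !eqxx mul1r mulr1 !addr0.
    by rewrite !mxE (negPf mk) mul0r.
  by rewrite [delta_mx _ _ _ _]mxE (negPf ml) mulr0.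
have Aji : A j i = A i j by rewrite -[in LHS]symA mxE.
have -> : (t *: delta_mx i ord0 + delta_mx j ord0)^T =
    t *: (delta_mx i ord0)^T + (delta_mx j ord0)^T :> 'rV[R]_n.
  by apply/matrixP => k l; rewrite !mxE.
rewrite !mulmxDl !mulmxDr -!scalemxAr -!scalemxAl.
have sumE (X Y : 'M[R]_1) : (X + Y) ord0 ord0 = X ord0 ord0 + Y ord0 ord0.
  by rewrite mxE.
have scaleE c (X : 'M[R]_1) : (c *: X) ord0 ord0 = c * X ord0 ord0.
  by rewrite mxE.
rewrite !sumE !scaleE !entry Aji => /le_trans; apply.
by rewrite le_eqVlt; apply/orP; left; apply/eqP; ring.
Qed.

Lemma psdmx_diag_ge0 (R : realType) n (A : 'M[R]_n) i : psdmx A -> 0 <= A i i.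
Proof.
by move/(psdmx_minor2 i i 0); rewrite expr0n /= !(mulr0, mul0r, add0r).
Qed.

(** When the diagonal entry is [0], the inequality of [psdmx_minor2] says that
    an affine function of [t] stays nonnegative, so its slope vanishes. *)
Lemma psdmx_row0 (R : realType) n (A : 'M[R]_n) i j :
  psdmx A -> A i i = 0 -> A i j = 0.
Proof.
move=> psdA Aii0; apply/eqP; apply: contraT => Aij0.
(* This value of [t] makes the affine function equal to [-1]. *)
have := psdmx_minor2 i j (- (A j j + 1) / (2 * A i j)) psdA.
rewrite Aii0 mulr0 add0r.
have -> : 2 * (- (A j j + 1) / (2 * A i j)) * A i j = - (A j j + 1).
  by field.
lra.
Qed.

Lemma quad_form_block (R : realType) n (a s : R) (v w : 'cV[R]_n)
    (S : 'M[R]_n) :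
  ((col_mx s%:M w)^T *m block_mx a%:M v^T v S *m col_mx s%:M w) ord0 ord0 =
  a * s ^+ 2 + 2 * s * (v^T *m w) ord0 ord0 + (w^T *m S *m w) ord0 ord0.
Proof.
have addE (X Y : 'M[R]_1) : (X + Y) ord0 ord0 = X ord0 ord0 + Y ord0 ord0.
  by rewrite mxE.
have scaleE c (X : 'M[R]_1) : (c *: X) ord0 ord0 = c * X ord0 ord0.
  by rewrite mxE.
have wv : (w^T *m v) ord0 ord0 = (v^T *m w) ord0 ord0.
  by rewrite -[v in LHS]trmxK -trmx_mul mxE.
rewrite tr_col_mx mul_row_block mul_row_col !mulmxDl tr_scalar_mx !addE.
rewrite -!scalar_mxM mul_mx_scalar mul_scalar_mx -scalemxAl !scaleE wv.
by rewrite [_%:M ord0 ord0]mxE eqxx mulr1n; ring.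
Qed.

(** The quadratic form of the Schur complement at [w] is the form of the whole
    matrix at [(s, w)] for the [s] that minimizes it.  With the convention
    [0^-1 = 0] this holds for a zero pivot as well. *)
Lemma schur_psdmx (R : realType) n (a : R) (v : 'cV[R]_n) (S : 'M[R]_n) :
  psdmx (block_mx a%:M v^T v S) -> psdmx (S - a^-1 *: (v *m v^T)).
Proof.
case=> symA posA; split.
  move: symA; rewrite tr_block_mx => /eq_block_mx[_ _ _ symS].
  by rewrite linearB linearZ /= trmx_mul trmxK symS.
move=> w; have := posA (col_mx (- a^-1 * (v^T *m w) ord0 ord0)%:M w).
rewrite quad_form_block mulmxBr mulmxBl -scalemxAr -scalemxAl.
have -> : w^T *m (v *m v^T) *m w = (v^T *m w)^T *m (v^T *m w).
  by rewrite trmx_mul trmxK !mulmxA.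
set c := v^T *m w.
have -> : (w^T *m S *m w - a^-1 *: (c^T *m c)) ord0 ord0 =
    (w^T *m S *m w) ord0 ord0 - a^-1 * c ord0 ord0 ^+ 2.
  have cc : (c^T *m c) ord0 ord0 = c ord0 ord0 ^+ 2.
    by rewrite mxE big_ord1 [c^T _ _]mxE expr2.
  by rewrite -cc !mxE.
have [->|a0] := eqVneq a 0.
  by rewrite invr0 !mul0r subr0 oppr0 !mul0r mulr0 mul0r !add0r.
by congr (0 <= _); field.
Qed.

(** One step of Cholesky elimination, then induction on the Schur complement.
    If the pivot [a] vanishes then so does its column [v], and the same block
    matrix, with zero first row, is still a factor. *)
Lemma psdmx_factor (R : realType) n (A : 'M[R]_n) :
  psdmx A -> exists B : 'M[R]_n, A = B^T *m B.
Proof.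
elim: n A => [|n IHn] A psdA; first by exists 0; apply/matrixP => -[].
rewrite -[n.+1]/(1 + n)%N in A psdA *.
have [symA _] := psdA.
have a_ge0 := psdmx_diag_ge0 ord0 psdA.
pose a := A ord0 ord0; pose v : 'cV_n := dlsubmx A.
have v0 : a = 0 -> v = 0.
  move=> a0; apply/colP => i; rewrite /v -symA !mxE.
  rewrite (_ : lshift _ _ = ord0 :> 'I_(1 + n)); last exact/val_inj.
  exact: psdmx_row0 psdA a0.
have AE : A = block_mx a%:M v^T v (drsubmx A).
  rewrite -[LHS]submxK trmx_dlsub symA; congr block_mx.
  by rewrite [LHS]mx11_scalar !mxE; congr (A _ _)%:M; apply/val_inj.
rewrite AE in psdA *; have [C schurE] := IHn _ (schur_psdmx psdA).
pose s := Num.sqrt a.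
have ss : s * s = a by rewrite -expr2 sqr_sqrtr.
have sv : (s * s^-1) *: v = v.
  have [a0|a0] := eqVneq a 0; first by rewrite (v0 a0) scaler0.
  by rewrite divff ?scale1r// sqrtr_eq0 -ltNge lt_def a0.
exists (block_mx s%:M (s^-1 *: v^T) 0 C).
rewrite tr_block_mx mulmx_block !trmx0 tr_scalar_mx.
have -> : (s^-1 *: v^T)^T = s^-1 *: v by apply/matrixP => i j; rewrite !mxE.
rewrite !mulmx0 !mul0mx !addr0; congr block_mx.
- by rewrite -scalar_mxM ss.
- rewrite mul_scalar_mx scalerA -[in LHS]sv.
  by apply/matrixP => i j; rewrite !mxE.
- by rewrite mul_mx_scalar scalerA sv.
- by rewrite addrC -schurE -scalemxAl -scalemxAr scalerA -invfM ss subrK.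
Qed.

(** * Factorization of the cost matrix *)

(** The entrywise product of the Gram matrices of two families of vectors is the
    Gram matrix of the tensor products of these vectors; this is the induction
    step on [q]. *)
Lemma gram_kernel_pow (R : realType) (X : Type) (k : X -> X -> R) (q n : nat)
    (x : 'I_n -> X) :
  psd_kernel k ->
  exists r (B : 'M[R]_(r, n)), kernel_mx (kernel_pow k q) x = B^T *m B.
Proof.
move=> [_ /(_ n x)/psdmx_factor[C CE]].
have kE i j : k (x i) (x j) = (C^T *m C) i j by rewrite -CE mxE.
elim: q => [|q [r [B BE]]].
  exists 1, (const_mx 1); apply/matrixP => i j.
  by rewrite !mxE big_ord1 !mxE mulr1 /kernel_pow expr0.
exists (n * r)%N, (\matrix_(i, j)
  (C (mxtens_unindex i).1 j * B (mxtens_unindex i).2 j)).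
apply/matrixP => i j; rewrite mxE /kernel_pow exprS {1}kE.
move/matrixP: BE => /(_ i j); rewrite [LHS]mxE /kernel_pow => ->.
rewrite !mxE mulr_sum; apply: eq_bigr => l _.
by rewrite !mxE; ring.
Qed.

Lemma kernel_pow_opp (R : realType) (X : Type) (k : X -> X -> R) q x y :
  kernel_pow (fun x y => - k x y) q x y = (-1) ^+ q * kernel_pow k q x y.
Proof. exact: exprNn. Qed.

Lemma nsd_kernel_opp (R : realType) (X : Type) (k : X -> X -> R) :
  nsd_kernel k -> psd_kernel (fun x y => - k x y).
Proof.
move=> [symk nsdk]; split=> [x y|s x]; first by rewrite symk.
have [symK negK] := nsdk s x.
have -> : kernel_mx (fun x y => - k x y) x = - kernel_mx k x.
  by apply/matrixP => i j; rewrite !mxE.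
split=> [|v]; first by rewrite linearN /= symK.
by rewrite mulmxN mulNmx mxE oppr_ge0.
Qed.

(** The tensor product of the factors of the two kernel matrices may have too
    many rows; since any Gram matrix is positive semidefinite, [psdmx_factor]
    then provides a square factor. *)
Lemma cost_mx_factor_psd (R : realType) (X0 X1 : Type) (k0 : X0 -> X0 -> R)
    (k1 : X1 -> X1 -> R) q N0 N1 (x0 : 'I_N0 -> X0) (x1 : 'I_N1 -> X1) :
  psd_kernel k0 -> psd_kernel k1 ->
  exists B : 'M[R]_(N0 * N1), cost_mx k0 k1 q x0 x1 = B^T *m B.
Proof.
move=> psd0 psd1.
have [r0 [B0 B0E]] := gram_kernel_pow q x0 psd0.
have [r1 [B1 B1E]] := gram_kernel_pow q x1 psd1.
apply: psdmx_factor.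
suff -> : cost_mx k0 k1 q x0 x1 = (2 *: (B0 *t B1))^T *m (2 *: (B0 *t B1)).
  exact: gram_psdmx.
rewrite /cost_mx B0E B1E; apply/matrixP => i j.
rewrite !mxE mulr_sum mulr_sumr; apply: eq_bigr => l _.
by rewrite !mxE; ring.
Qed.

Lemma cost_mx_factor (R : realType) (X0 X1 : Type) (k0 : X0 -> X0 -> R)
    (k1 : X1 -> X1 -> R) q N0 N1 (x0 : 'I_N0 -> X0) (x1 : 'I_N1 -> X1) :
  (psd_kernel k0 /\ psd_kernel k1) \/ (nsd_kernel k0 /\ nsd_kernel k1) ->
  exists B : 'M[R]_(N0 * N1), cost_mx k0 k1 q x0 x1 = B^T *m B.
Proof.
case=> [[psd0 psd1]|[/nsd_kernel_opp psd0 /nsd_kernel_opp psd1]].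
  exact: cost_mx_factor_psd.
have [B BE] := cost_mx_factor_psd q x0 x1 psd0 psd1.
exists B; rewrite -BE; apply/matrixP => i j; rewrite !mxE !kernel_pow_opp.
by rewrite mulrACA -expr2 sqrr_sign mul1r.
Qed.

(** * Existence of the inner minimum *)

(** Apply [ln s < s] to the inverse [s] of the square root of [t]. *)
Lemma normr_mulr_ln (R : realType) (t : R) : 0 <= t <= 1 ->
  `|t * ln t| <= 2 * Num.sqrt t.
Proof.
move=> /andP[]; rewrite le_eqVlt => /predU1P[<-|t0] t1.
  by rewrite mul0r normr0 sqrtr0 mulr0.
have s0 : 0 < Num.sqrt t by rewrite sqrtr_gt0.
have tE : t = Num.sqrt t ^+ 2 by rewrite sqr_sqrtr// ltW.
rewrite normrM (gtr0_norm t0) ler0_norm ?ln_le0//.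
have := ln_sublinear (x := (Num.sqrt t)^-1); rewrite invr_gt0 => /(_ s0).
rewrite lnV ?posrE// => lns.
rewrite [in leLHS]tE lnXn// expr2.
rewrite -mulrA (mulrC 2) ler_pM2l// mulr2n.
have : Num.sqrt t * - ln (Num.sqrt t) <= 1.
  by rewrite -(@mulfV _ (Num.sqrt t)) ?gt_eqF// ler_pM2l// ltW.
lra.
Qed.

(** On the negative axis this relies on the convention that [ln] vanishes
    there. *)
Lemma continuous_mulr_ln (R : realType) : continuous (fun t : R => t * ln t).
Proof.
move=> t; have [t0|t0|->] := ltgtP t 0.
- apply: (@near_cst_continuous _ _ 0).
  near=> s; rewrite ln0 ?mulr0//; apply/ltW; near: s; exact: lt_nbhsl.
- by apply: continuousM; [exact: cvg_id | exact: continuous_ln].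
- rewrite /continuous_at mul0r.
  apply/cvgr0Pnorm_lt => e e0; have e20 : 0 < e / 2 by rewrite divr_gt0.
  near=> s.
  have [s0|s0] := leP s 0; first by rewrite ln0// mulr0 normr0.
  apply: le_lt_trans (normr_mulr_ln _) _.
    by rewrite (ltW s0) /=; apply/ltW; near: s; exact: lt_nbhsl ltr01.
  rewrite mulrC -ltr_pdivlMr// -[ltRHS](ger0_norm (ltW e20)) -sqrtr_sqr.
  rewrite ltr_sqrt ?exprn_gt0//.
  by near: s; apply: lt_nbhsl; exact: exprn_gt0.
Unshelve. all: by end_near.
Qed.

Lemma continuous_coord_sum (R : realType) n (phi : 'I_n -> R -> R) :
  (forall j, continuous (phi j)) ->
  continuous (fun w : 'rV[R]_n => \sum_j phi j (w ord0 j)).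
Proof.
move=> cphi; elim: (index_enum _) => [|j s IHs].
  by under eq_fun do rewrite big_nil; exact: cst_continuous.
under eq_fun do rewrite big_cons.
move=> w; apply: continuousD; last exact: IHs.
by apply: continuous_comp; [exact: coord_continuous | exact: cphi].
Qed.

(** A closed subset of the unit box; the transpose passes to row vectors, the
    form in which Tychonoff's theorem applies. *)
Lemma compact_feasible (R : realType) m n (A : 'M[R]_(m, n)) (b : 'cV[R]_m) :
  (forall x, feasible A b x -> forall i, x i ord0 <= 1) ->
  compact [set w : 'rV[R]_n | feasible A b w^T].
Proof.
move=> le1; apply: (@subclosed_compact _ _
  [set w : 'rV[R]_n | forall i, `[0, 1]%classic (w ord0 i)]).
- have -> : [set w : 'rV[R]_n | feasible A b w^T] =
    (\bigcap_(i in [set: 'I_m])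
       [set w : 'rV[R]_n | \sum_j A i j * w ord0 j = b i ord0])
    `&` (\bigcap_(i in [set: 'I_n]) [set w : 'rV[R]_n | 0 <= w ord0 i]).
    apply/seteqP; split=> w /=.
      move=> [Aw w0]; split=> i _ /=; last by have := w0 i; rewrite mxE.
      by rewrite -Aw !mxE; apply: eq_bigr => j _; rewrite mxE.
    move=> [Aw w0]; split=> [|i]; last by rewrite mxE; exact: w0.
    apply/colP => i; rewrite -(Aw i)// mxE.
    by apply: eq_bigr => j _; rewrite mxE.
  apply: closedI; apply: closed_bigI => i _.
    apply: (@preimage_closed _ _ (fun w => _) [set b i ord0]);
      last exact: closed_eq.
    move=> w _; apply: (@continuous_coord_sum _ _ (fun j t => A i j * t)) => j.
    exact: mulrl_continuous.
  apply: (@preimage_closed _ _ (fun w : 'rV[R]_n => w ord0 i) [set t | 0 <= t]);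
    last exact: closed_ge.
  by move=> w _; exact: coord_continuous.
- apply: (@rV_compact R n (fun=> `[0, 1]%classic)) => i.
  exact: segment_compact.
- move=> w /= Fw i; rewrite in_itv /=; have [_ /(_ i)] := Fw.
  by have := le1 _ Fw i; rewrite !mxE => -> ->.
Qed.

Definition neg_entropy (R : realType) n (x : 'cV[R]_n) : R :=
  \sum_i x i ord0 * ln (x i ord0).

Lemma inner_valueE (R : realType) m n r (A : 'M[R]_(m, n)) (b : 'cV[R]_m)
    (B : 'M[R]_(r, n)) (eps : R) (u : 'cV[R]_r) (x : 'cV[R]_n) :
  feasible A b x ->
  ((- (u^T *m B *m x) ord0 ord0)%:E - eps%:E * vec_entropy x =
   (- (u^T *m B *m x) ord0 ord0 + eps * neg_entropy x)%:E)%E.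
Proof.
move=> [_ /forallP x0]; rewrite /vec_entropy x0 -EFinM -EFinB.
by rewrite mulrN opprK.
Qed.

Lemma inner_values_min (R : realType) m n r (A : 'M[R]_(m, n)) (b : 'cV[R]_m)
    (B : 'M[R]_(r, n)) (eps : R) (u : 'cV[R]_r) :
  feasible A b !=set0 ->
  (forall x, feasible A b x -> forall i, x i ord0 <= 1) ->
  exists v, is_min (inner_values A b B eps u) v.
Proof.
move=> [y Fy] le1.
pose phi j (t : R) := - (u^T *m B) ord0 j * t + eps * (t * ln t).
pose f (w : 'rV[R]_n) := \sum_j phi j (w ord0 j).
have cf : continuous f.
  apply: continuous_coord_sum => j t; apply: cvgD.
    exact: mulrl_continuous.
  by apply: cvgMr; exact: continuous_mulr_ln.
have valE x : feasible A b x ->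
    ((- (u^T *m B *m x) ord0 ord0)%:E - eps%:E * vec_entropy x =
     (f x^T)%:E)%E.
  move=> Fx; rewrite (inner_valueE _ _ _ Fx); congr _%:E.
  rewrite [(_ *m x) _ _]mxE mulr_sumr -sumrN -big_split /=.
  by apply: eq_bigr => j _; rewrite /phi [x^T _ _]mxE mulNr.
have K0 : [set w : 'rV[R]_n | feasible A b w^T] !=set0.
  by exists y^T; rewrite /= trmxK.
have [w] := compact_EVT_min K0 (compact_feasible le1) (continuous_subspaceT cf).
rewrite inE => Fw min_w; exists (f w)%:E; split=> [|_ [x Fx <-]].
  by exists w^T => //; rewrite valE ?trmxK.
by rewrite valE// lee_fin min_w// inE /= trmxK.
Qed.

(** * Probabilities on finite discrete spaces *)

Definition mass_vec (R : realType) d (T : measurableType d) n (x : 'I_n -> T)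
    (P : probability T R) : 'cV[R]_n := \col_i fine (P [set x i]).

Lemma integral_discrete (R : realType) d (T : measurableType d)
    (discreteT : forall E : set T, measurable E) n (x : 'I_n -> T)
    (x_bij : bijective x) (P : probability T R) (f : T -> R) :
  (\int[P]_z (f z)%:E = (\sum_i fine (P [set x i]) * f (x i))%:E)%E.
Proof.
have -> : [set: T] = \big[setU/set0]_(i <- index_enum 'I_n) [set x i].
  apply/seteqP; split=> // z _; have [y xK yK] := x_bij.
  by rewrite -bigcup_seq; exists (y z); rewrite /= ?yK ?mem_index_enum.
rewrite integral_bigsetU_EFin; last 1 first.
- by move=> _ Y _; apply: discreteT.
- rewrite -sumEFin; apply: eq_bigr => i _.
  rewrite (eq_integral (cst (f (x i))%:E)) ?integral_cst//.
    by rewrite muleC EFinM fineK// fin_num_measure.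
  by move=> z; rewrite inE /= => ->.
- by move=> i; apply: discreteT.
- exact: index_enum_uniq.
- by move=> i j _ _ [z [/= ->]]; exact: bij_inj.
Qed.

Lemma integral2_discrete (R : realType) d (T : measurableType d) n
    (y : 'I_n -> T) (P : probability T R) (f : T -> T -> R) :
  (forall E : set T, measurable E) -> bijective y ->
  (\int[P]_z \int[P]_z' (f z z')%:E =
   (\sum_i \sum_j mass_vec y P i ord0 * mass_vec y P j ord0
                  * f (y i) (y j))%:E)%E.
Proof.
move=> mT y_bij; under eq_integral do rewrite (integral_discrete mT y_bij).
rewrite (integral_discrete mT y_bij); congr _%:E.
apply: eq_bigr => i _; rewrite mulr_sumr; apply: eq_bigr => j _.
by rewrite !mxE mulrA.
Qed.

Lemma measure_discrete (R : realType) d (T : measurableType d)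
    (discreteT : forall E : set T, measurable E) n (x : 'I_n -> T)
    (x_bij : bijective x) (P : probability T R) (E : set T) :
  (P E = (\sum_i fine (P [set x i]) * \1_E (x i))%:E)%E.
Proof.
by rewrite -(integral_discrete discreteT x_bij) integral_indic// setIT.
Qed.

Lemma sum_mass1 (R : realType) d (T : measurableType d) n (x : 'I_n -> T)
    (P : probability T R) :
  (forall E : set T, measurable E) -> bijective x ->
  \sum_i fine (P [set x i]) = 1.
Proof.
move=> mT x_bij; have := measure_discrete mT x_bij P setT.
rewrite probability_setT => -[->].
by apply: eq_bigr => i _; rewrite indicT mulr1.
Qed.

(** Indexed by [nat] because the finite sum of measures is taken over an
    initial segment of a sequence. *)
Definition atomic_measure (R : realType) d (T : measurableType d)
    (x : nat -> T) (w : nat -> {nonneg R}) (n : nat) : set T -> \bar R :=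
  msum (fun k => mscale (w k) (dirac (x k))) n.

HB.instance Definition _ R d T x w n :=
  Measure.on (@atomic_measure R d T x w n).

Lemma atomic_probability (R : realType) d (T : measurableType d)
    n (x : 'I_n -> T) (w : 'I_n -> R) :
  (forall i, 0 <= w i) -> \sum_i w i = 1 ->
  exists P : probability T R, forall E, P E = (\sum_i w i * \1_E (x i))%:E.
Proof.
case: n x w => [|n] x w w0 w1.
  by move: w1; rewrite big_ord0 => /esym/eqP; rewrite oner_eq0.
pose m := atomic_measure (fun k => x (inord k))
            (fun k => NngNum (w0 (inord k))) n.+1.
have mE E : m E = (\sum_i w i * \1_E (x i))%:E.
  rewrite /m /atomic_measure /msum -sumEFin; apply: eq_bigr => i _.
  by rewrite /mscale /= /dirac inord_val EFinM.
have mT : m [set: T] = 1%E.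
  rewrite mE -w1; congr _%:E; apply: eq_bigr => i _.
  by rewrite indicT mulr1.
pose mP := Measure_isProbability.Build _ _ _ m mT.
pose P : probability T R := HB.pack m mP.
by exists P.
Qed.

Lemma sum_indic1 (R : pzRingType) (V : Type) n (y : 'I_n -> V) (m : 'I_n)
    (G : 'I_n -> R) :
  injective y -> \sum_i G i * \1_[set y m] (y i) = G m.
Proof.
move=> y_inj; rewrite (bigD1 m) //= big1 => [|i im].
  by rewrite indicE mem_set // mulr1 addr0.
by rewrite indicE memNset ?mulr0 // => /y_inj/eqP; rewrite (negPf im).
Qed.

Lemma fsum_bij (V : nmodType) (T : choiceType) n (x : 'I_n -> T) (F : T -> V) :
  bijective x -> \sum_(z \in [set: T]) F z = \sum_i F (x i).
Proof.
move=> x_bij; rewrite (fsbigE (map x (index_enum 'I_n))).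
- by rewrite big_map; apply: eq_bigl => i; rewrite in_setT.
- by rewrite map_inj_uniq ?index_enum_uniq//; exact: bij_inj.
- by [].
- move=> z _ /negP[]; have [y xK yK] := x_bij.
  by rewrite -[z]yK map_f// mem_index_enum.
Qed.

(** * Products of finite discrete spaces *)

(** The order of enumeration is that of the columns of the constraint matrix
    and of the cost matrix. *)
Definition pair_point (T0 T1 : Type) N0 N1 (x0 : 'I_N0 -> T0)
    (x1 : 'I_N1 -> T1) (k : 'I_(N0 * N1)) : T0 * T1 :=
  (x0 (mxtens_unindex k).1, x1 (mxtens_unindex k).2).

Lemma pair_point_index (T0 T1 : Type) N0 N1 (x0 : 'I_N0 -> T0)
    (x1 : 'I_N1 -> T1) m l :
  pair_point x0 x1 (mxtens_index (m, l)) = (x0 m, x1 l).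
Proof. by rewrite /pair_point mxtens_indexK. Qed.

Lemma pair_point_bij (T0 T1 : Type) N0 N1 (x0 : 'I_N0 -> T0)
    (x1 : 'I_N1 -> T1) :
  bijective x0 -> bijective x1 -> bijective (pair_point x0 x1).
Proof.
move=> [y0 x0K y0K] [y1 x1K y1K].
exists (fun z => mxtens_index (y0 z.1, y1 z.2)) => [k|[z0 z1]].
  rewrite -[LHS]/(mxtens_index (y0 (x0 (mxtens_unindex k).1),
                                y1 (x1 (mxtens_unindex k).2))).
  by rewrite x0K x1K -surjective_pairing mxtens_unindexK.
by rewrite /pair_point mxtens_indexK /= y0K y1K.
Qed.

(** The product sigma-algebra contains the singletons, which are rectangles,
    hence all subsets of the finite product. *)
Lemma measurable_pair_discrete d0 d1 (X0 : measurableType d0)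
    (X1 : measurableType d1) N0 N1 (x0 : 'I_N0 -> X0) (x1 : 'I_N1 -> X1) :
  (forall E : set X0, measurable E) -> (forall E : set X1, measurable E) ->
  bijective x0 -> bijective x1 ->
  forall E : set (X0 * X1), measurable E.
Proof.
move=> m0 m1 b0 b1 E; have [y xK yK] := pair_point_bij b0 b1.
have -> : E = \bigcup_(k in [set k | E (pair_point x0 x1 k)])
                [set pair_point x0 x1 k].
  apply/seteqP; split=> [z Ez|z [k Ek ->]]; last exact: Ek.
  by exists (y z); rewrite /= yK.
apply: fin_bigcup_measurable => [|k _]; first exact: finite_finset.
rewrite (_ : [set _] =
  [set x0 (mxtens_unindex k).1] `*` [set x1 (mxtens_unindex k).2]).
  by apply: measurableX; [exact: m0|exact: m1].
by apply/seteqP; split=> -[a b] /=; [case=> -> ->|case=> -> ->].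
Qed.

Lemma sum_mxtens (V : nmodType) N0 N1 (F : 'I_(N0 * N1) -> V) :
  \sum_k F k = \sum_i \sum_j F (mxtens_index (i, j)).
Proof.
rewrite pair_big /= (reindex (@mxtens_index N0 N1)) /=.
  by apply: eq_bigr => -[i j] _.
exists (@mxtens_unindex N0 N1) => k _; first exact: mxtens_indexK.
exact: mxtens_unindexK.
Qed.

Lemma coupling_mx_row0 (R : realType) N0 N1 (x : 'cV[R]_(N0 * N1)) m :
  (coupling_mx R N0 N1 *m x) (lshift N1 m) ord0 =
  \sum_l x (mxtens_index (m, l)) ord0.
Proof.
have rowE i j :
    coupling_mx R N0 N1 (lshift N1 m) (mxtens_index (i, j)) = (m == i)%:R.
  rewrite /coupling_mx castmxE cast_ord_id.
  have -> : cast_ord (esym (f_equal2 addn (muln1 N0) (mul1n N1)))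
        (lshift N1 m) = lshift (1 * N1) (mxtens_index (m, ord0 : 'I_1)).
    by apply/val_inj; rewrite /= muln1 addn0.
  by rewrite col_mxEu tensmxE !mxE mulr1.
rewrite mxE sum_mxtens (bigD1 m) //= [X in _ + X]big1 => [|i /negPf im].
  by rewrite addr0; apply: eq_bigr => l _; rewrite rowE eqxx mul1r.
by apply: big1 => l _; rewrite rowE eq_sym im mul0r.
Qed.

Lemma coupling_mx_row1 (R : realType) N0 N1 (x : 'cV[R]_(N0 * N1)) l :
  (coupling_mx R N0 N1 *m x) (rshift N0 l) ord0 =
  \sum_m x (mxtens_index (m, l)) ord0.
Proof.
have rowE i j :
    coupling_mx R N0 N1 (rshift N0 l) (mxtens_index (i, j)) = (l == j)%:R.
  rewrite /coupling_mx castmxE cast_ord_id.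
  have -> : cast_ord (esym (f_equal2 addn (muln1 N0) (mul1n N1)))
        (rshift N0 l) = rshift (N0 * 1) (mxtens_index (ord0 : 'I_1, l)).
    by apply/val_inj; rewrite /= muln1 mul0n.
  by rewrite col_mxEd tensmxE !mxE mul1r.
rewrite mxE sum_mxtens; apply: eq_bigr => i _.
rewrite (bigD1 l) //= big1 => [|j /negPf jl].
  by rewrite addr0 rowE eqxx mul1r.
by rewrite rowE eq_sym jl mul0r.
Qed.

Lemma feasible_couplingP (R : realType) d0 d1 (X0 : measurableType d0)
    (X1 : measurableType d1) (mu0 : probability X0 R) (mu1 : probability X1 R)
    N0 N1 (x0 : 'I_N0 -> X0) (x1 : 'I_N1 -> X1) (x : 'cV[R]_(N0 * N1)) :
  feasible (coupling_mx R N0 N1) (marginal_vec mu0 mu1 x0 x1) x <->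
  [/\ forall m, \sum_l x (mxtens_index (m, l)) ord0 = fine (mu0 [set x0 m]),
      forall l, \sum_m x (mxtens_index (m, l)) ord0 = fine (mu1 [set x1 l]) &
      forall k, 0 <= x k ord0].
Proof.
split=> [[Ax x_ge0]|[row0 row1 x_ge0]].
  split=> // i; first by rewrite -coupling_mx_row0 Ax col_mxEu mxE.
  by rewrite -coupling_mx_row1 Ax col_mxEd mxE.
split=> //; apply/colP => i; case: (split_ordP i) => j ->.
  by rewrite coupling_mx_row0 row0 col_mxEu mxE.
by rewrite coupling_mx_row1 row1 col_mxEd mxE.
Qed.

(** * Couplings as feasible vectors *)

Section FiniteSpaces.
Context (R : realType) (d0 d1 : measure_display).
Context (X0 : measurableType d0) (X1 : measurableType d1).
Context (discrete0 : forall E : set X0, measurable E).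
Context (discrete1 : forall E : set X1, measurable E).
Context (N0 N1 : nat) (x0 : 'I_N0 -> X0) (x1 : 'I_N1 -> X1).
Context (x0_bij : bijective x0) (x1_bij : bijective x1).
Context (mu0 : probability X0 R) (mu1 : probability X1 R).

Let discrete01 := measurable_pair_discrete discrete0 discrete1 x0_bij x1_bij.
Let point_bij := pair_point_bij x0_bij x1_bij.
Local Notation point := (pair_point x0 x1).
Local Notation feasible_set :=
  (feasible (coupling_mx R N0 N1) (marginal_vec mu0 mu1 x0 x1)).

Lemma coupling_feasible (pi : probability (X0 * X1)%type R) :
  couplings mu0 mu1 pi -> feasible_set (mass_vec point pi).
Proof.
move=> [pi0 pi1]; apply/feasible_couplingP; split=> [m|l|k].
- rewrite -pi0 // /pushforward (measure_discrete discrete01 point_bij) /=.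
  rewrite sum_mxtens -[LHS](sum_indic1 m
    (fun m => \sum_l _ (mxtens_index (m, l)) _) (bij_inj x0_bij)).
  apply: eq_bigr => i _; rewrite mulr_suml; apply: eq_bigr => j _.
  by rewrite mxE pair_point_index.
- rewrite -pi1 // /pushforward (measure_discrete discrete01 point_bij) /=.
  rewrite sum_mxtens exchange_big /= -[LHS](sum_indic1 l
    (fun l => \sum_m _ (mxtens_index (m, l)) _) (bij_inj x1_bij)).
  apply: eq_bigr => i _; rewrite mulr_suml; apply: eq_bigr => j _.
  by rewrite mxE pair_point_index.
- by rewrite mxE fine_ge0.
Qed.

Lemma feasible_coupling x : feasible_set x ->
  exists2 pi, couplings mu0 mu1 pi & mass_vec point pi = x.
Proof.
move=> /feasible_couplingP[row0 row1 x_ge0].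
have x_sum1 : \sum_k x k ord0 = 1.
  rewrite -(sum_mass1 mu0 discrete0 x0_bij) sum_mxtens.
  by apply: eq_bigr => i _; rewrite row0.
have [pi piE] := atomic_probability point x_ge0 x_sum1.
exists pi; last first.
  apply/colP => k; rewrite mxE piE /=.
  exact: (sum_indic1 k (fun k => x k ord0) (bij_inj point_bij)).
split=> E _; rewrite /pushforward piE sum_mxtens.
  rewrite (measure_discrete discrete0 x0_bij); congr _%:E.
  apply: eq_bigr => i _; rewrite -row0 mulr_suml; apply: eq_bigr => j _.
  by rewrite pair_point_index.
rewrite (measure_discrete discrete1 x1_bij) exchange_big; congr _%:E.
apply: eq_bigr => i _; rewrite -row1 mulr_suml; apply: eq_bigr => j _.
by rewrite pair_point_index.
Qed.

Lemma feasible_nonempty : feasible_set !=set0.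
Proof.
(* the product coupling *)
exists (\col_k (fine (mu0 [set x0 (mxtens_unindex k).1]) *
                fine (mu1 [set x1 (mxtens_unindex k).2]))).
apply/feasible_couplingP; split=> [m|l|k].
- under eq_bigr do rewrite mxE mxtens_indexK /=.
  by rewrite -mulr_sumr sum_mass1 // mulr1.
- under eq_bigr do rewrite mxE mxtens_indexK /=.
  by rewrite -mulr_suml sum_mass1 // mul1r.
- by rewrite mxE mulr_ge0 // fine_ge0.
Qed.

Lemma feasible_le1 x : feasible_set x -> forall k, x k ord0 <= 1.
Proof.
move=> Fx k; have [row0 _ x_ge0] := (feasible_couplingP _ _ _ _ _).1 Fx.
rewrite -[k]mxtens_unindexK; case: (mxtens_unindex k) => m l.
apply: (@le_trans _ _ (fine (mu0 [set x0 m]))).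
  by rewrite -row0 (bigD1 l) //= lerDl sumr_ge0.
by rewrite -lee_fin fineK ?fin_num_measure // probability_le1.
Qed.

Lemma coupling_entropyE (pi : probability (X0 * X1)%type R) :
  coupling_entropy pi = - neg_entropy (mass_vec point pi).
Proof.
rewrite /coupling_entropy (fsum_bij _ point_bij); congr (- _).
by apply: eq_bigr => k _; rewrite mxE.
Qed.

(** * The objective as a function of the feasible vector *)

Context (k0 : X0 -> X0 -> R) (k1 : X1 -> X1 -> R) (q : nat).

Definition marginal_const : R :=
  \sum_i \sum_j fine (mu0 [set x0 i]) * fine (mu0 [set x0 j])
     * kernel_pow k0 q (x0 i) (x0 j) ^+ 2 +
  \sum_i \sum_j fine (mu1 [set x1 i]) * fine (mu1 [set x1 j])
     * kernel_pow k1 q (x1 i) (x1 j) ^+ 2.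

Lemma EGW_constE : EGW_const q k0 k1 mu0 mu1 = marginal_const%:E.
Proof.
rewrite /EGW_const (integral2_discrete _ _ discrete0 x0_bij).
rewrite (integral2_discrete _ _ discrete1 x1_bij) -EFinD; congr _%:E.
rewrite /marginal_const /kernel_pow; congr (_ + _);
  by apply: eq_bigr => i _; apply: eq_bigr => j _; rewrite !mxE mulnC exprM.
Qed.

(** In the expanded square, each pure term involves one factor of the product
    only, so the vector can be summed to its marginal; the cross term is the
    quadratic form of the cost matrix, whose factor [4] turns [2] into
    [2^-1]. *)
Lemma cost_feasible (x : 'cV[R]_(N0 * N1)) : feasible_set x ->
  \sum_k \sum_k' x k ord0 * x k' ord0 *
    `|kernel_pow k0 q (point k).1 (point k').1 -
      kernel_pow k1 q (point k).2 (point k').2| ^+ 2 =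
  marginal_const - 2^-1 * (x^T *m cost_mx k0 k1 q x0 x1 *m x) ord0 ord0.
Proof.
move=> /feasible_couplingP[row0 row1 _].
set K0 := kernel_pow k0 q; set K1 := kernel_pow k1 q.
have quadE : (x^T *m cost_mx k0 k1 q x0 x1 *m x) ord0 ord0 =
    \sum_k \sum_k' x k ord0 * x k' ord0 *
      (4 * (K0 (point k).1 (point k').1 * K1 (point k).2 (point k').2)).
  rewrite mxE exchange_big /=; apply: eq_bigr => k _.
  rewrite mxE mulr_suml; apply: eq_bigr => k' _.
  by rewrite !mxE /K0 /K1 /pair_point /=; ring.
have margE0 :
    \sum_k \sum_k' x k ord0 * x k' ord0 * K0 (point k).1 (point k').1 ^+ 2 =
    \sum_i \sum_j fine (mu0 [set x0 i]) * fine (mu0 [set x0 j])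
                  * K0 (x0 i) (x0 j) ^+ 2.
  rewrite sum_mxtens; apply: eq_bigr => i _.
  under eq_bigr do rewrite sum_mxtens.
  rewrite exchange_big; apply: eq_bigr => j _; rewrite -!row0.
  rewrite !mulr_suml; apply: eq_bigr => l _.
  rewrite mulr_sumr mulr_suml; apply: eq_bigr => l' _.
  by rewrite !pair_point_index.
have margE1 :
    \sum_k \sum_k' x k ord0 * x k' ord0 * K1 (point k).2 (point k').2 ^+ 2 =
    \sum_i \sum_j fine (mu1 [set x1 i]) * fine (mu1 [set x1 j])
                  * K1 (x1 i) (x1 j) ^+ 2.
  rewrite sum_mxtens exchange_big; apply: eq_bigr => i _.
  under eq_bigr do rewrite sum_mxtens exchange_big.
  rewrite exchange_big; apply: eq_bigr => j _; rewrite -!row1.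
  rewrite !mulr_suml; apply: eq_bigr => l _.
  rewrite mulr_sumr mulr_suml; apply: eq_bigr => l' _.
  by rewrite !pair_point_index.
rewrite quadE /marginal_const -margE0 -margE1 mulr_sumr -sumrN -!big_split /=.
apply: eq_bigr => k _; rewrite mulr_sumr -sumrN -!big_split /=.
by apply: eq_bigr => k' _; rewrite real_normK ?num_real //; field.
Qed.

Lemma sqnorm2_gram r n (B : 'M[R]_(r, n)) (x : 'cV[R]_n) :
  (x^T *m (B^T *m B) *m x) ord0 ord0 = sqnorm2 (B *m x).
Proof.
rewrite mulmxA -mulmxA -trmx_mul mxE; apply: eq_bigr => i _.
by rewrite mxE expr2.
Qed.

Lemma EGW2_feasible eps r (B : 'M[R]_(r, N0 * N1)) :
  cost_mx k0 k1 q x0 x1 = B^T *m B ->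
  EGW2 eps q k0 k1 mu0 mu1 =
  ereal_inf [set (marginal_const - 2^-1 * sqnorm2 (B *m x)
                  + eps * neg_entropy x)%:E | x in feasible_set].
Proof.
move=> ME.
have objE pi : couplings mu0 mu1 pi ->
  let x := mass_vec point pi in
  (\int[pi]_z \int[pi]_z'
     (`|kernel_pow k0 q z.1 z'.1 - kernel_pow k1 q z.2 z'.2| ^+ 2)%:E
   - (eps * coupling_entropy pi)%:E)%E =
  (marginal_const - 2^-1 * sqnorm2 (B *m x) + eps * neg_entropy x)%:E.
  move=> pi_coupling x; have Fx := coupling_feasible pi_coupling.
  rewrite (integral2_discrete pi
    (fun z z' => `|kernel_pow k0 q z.1 z'.1 - kernel_pow k1 q z.2 z'.2| ^+ 2)
    discrete01 point_bij).
  rewrite (cost_feasible Fx) ME sqnorm2_gram coupling_entropyE -EFinB.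
  by rewrite mulrN opprK.
congr ereal_inf; apply/seteqP; split=> [_ [pi pi_coupling <-]|_ [x Fx <-]].
  rewrite objE //; exists (mass_vec point pi) => //.
  exact: coupling_feasible.
have [pi pi_coupling <-] := feasible_coupling Fx.
by exists pi => //; rewrite objE.
Qed.

End FiniteSpaces.

(** * Quadratic duality *)

Lemma sqnorm2_dual_ge (R : realType) r (u y : 'cV[R]_r) :
  - (2^-1 * sqnorm2 y) <= 2^-1 * sqnorm2 u - (u^T *m y) ord0 ord0.
Proof.
rewrite mxE /sqnorm2 !mulr_sumr -!sumrN -big_split /=.
apply: ler_sum => i _; rewrite mxE.
have := sqr_ge0 (u i ord0 - y i ord0); nra.
Qed.

Lemma sqnorm2_dual_eq (R : realType) r (y : 'cV[R]_r) :
  2^-1 * sqnorm2 y - (y^T *m y) ord0 ord0 = - (2^-1 * sqnorm2 y).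
Proof.
have -> : (y^T *m y) ord0 ord0 = sqnorm2 y.
  by rewrite mxE; apply: eq_bigr => i _; rewrite mxE expr2.
by field.
Qed.

(** For the first inequality, a minimizer [x] of the inner problem at [u] is a
    competitor on the left, compared by [sqnorm2_dual_ge]; for the second,
    [u = B x] is a competitor on the right. *)
Lemma ereal_inf_quadratic_dual (R : realType) m n r (A : 'M[R]_(m, n))
    (b : 'cV[R]_m) (B : 'M[R]_(r, n)) (eps c : R)
    (inner_min : 'cV[R]_r -> \bar R) :
  (forall u, is_min (inner_values A b B eps u) (inner_min u)) ->
  ereal_inf [set (c - 2^-1 * sqnorm2 (B *m x) + eps * neg_entropy x)%:E
            | x in feasible A b] =
  (c%:E + ereal_inf [set (2^-1 * sqnorm2 u)%:E + inner_min u
                    | u in [set: 'cV[R]_r]])%E.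
Proof.
move=> minP; apply/eqP; rewrite eq_le; apply/andP; split.
- rewrite addeC -leeBlDr //; apply: le_ereal_inf_tmp => _ [u _ <-].
  have [[x Fx <-] _] := minP u.
  rewrite leeBlDr // (inner_valueE _ _ _ Fx) -mulmxA.
  apply: ge_ereal_inf.
  exists (c - 2^-1 * sqnorm2 (B *m x) + eps * neg_entropy x)%:E.
    by exists x.
  rewrite -!EFinD lee_fin; have := sqnorm2_dual_ge u (B *m x); lra.
- apply: le_ereal_inf_tmp => _ [x Fx <-].
  rewrite addeC -leeBrDr //; apply: ge_ereal_inf.
  exists ((2^-1 * sqnorm2 (B *m x))%:E + inner_min (B *m x))%E.
    by exists (B *m x).
  have [_ lb] := minP (B *m x).
  apply: (le_trans (leeD2l _ (lb _ (ex_intro2 _ _ x Fx erefl)))).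
  rewrite (inner_valueE _ _ _ Fx) -mulmxA -EFinD -EFinB lee_fin.
  have := sqnorm2_dual_eq (B *m x); lra.
Qed.

Theorem proposition6 (R : realType) (d0 d1 : measure_display)
  (X0 : measurableType d0) (X1 : measurableType d1)
  (discrete0 : forall E : set X0, measurable E)
  (discrete1 : forall E : set X1, measurable E)
  (N0 N1 : nat) (x0 : 'I_N0 -> X0) (x1 : 'I_N1 -> X1)
  (x0_bij : bijective x0) (x1_bij : bijective x1)
  (mu0 : probability X0 R) (mu1 : probability X1 R)
  (k0 : X0 -> X0 -> R) (k1 : X1 -> X1 -> R)
  (k_sign : (psd_kernel k0 /\ psd_kernel k1) \/
            (nsd_kernel k0 /\ nsd_kernel k1))
  (q : nat) (q_gt0 : (0 < q)%N) :
  let M := cost_mx k0 k1 q x0 x1 in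
  let A := coupling_mx R N0 N1 in
  let b := marginal_vec mu0 mu1 x0 x1 in
  (exists (r : nat) (B : 'M[R]_(r, N0 * N1)),
     (r <= N0 * N1)%N /\ M = B^T *m B) /\
  (forall (r : nat) (B : 'M[R]_(r, N0 * N1)),
     (r <= N0 * N1)%N -> M = B^T *m B ->
     forall eps : R, 0 <= eps ->
     exists inner_min : 'cV[R]_r -> \bar R,
       (forall u, is_min (inner_values A b B eps u) (inner_min u)) /\
       EGW2 eps q k0 k1 mu0 mu1 =
         (EGW_const q k0 k1 mu0 mu1 +
          ereal_inf [set (2^-1 * sqnorm2 u)%:E + inner_min u
                    | u in [set: 'cV[R]_r]])%E).
Proof.
move=> M A b; split.
  have [B ME] := cost_mx_factor q x0 x1 k_sign.
  by exists (N0 * N1)%N, B.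
move=> r B _ ME eps _.
have min_ex u : exists v, is_min (inner_values A b B eps u) v.
  apply: inner_values_min; first exact: feasible_nonempty.
  exact: feasible_le1.
have [inner_min minP] := choice min_ex.
exists inner_min; split=> //.
rewrite (EGW_constE discrete0 discrete1 x0_bij x1_bij).
rewrite (EGW2_feasible discrete0 discrete1 x0_bij x1_bij mu0 mu1 eps ME).
exact: ereal_inf_quadratic_dual.
Qed.
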